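(* The constrained minimum-cost inverse optimization problem $(S,\mathcal{F},F^*,\{c^j\}_{j\in[k]},\ell,u,\|\cdot\|_{\infty,w})$ with multiple cost functions under the weighted $\ell_\infty$-norm objective can be solved using $O(k\cdot n\cdot\|w\|_{-1})$ calls to the oracle $\mathcal{O}$, where $n=|S|$ and $k$ is the number of cost functions. That is, there is an algorithm which for every instance makes $O(k\cdot n\cdot\|w\|_{-1})$ calls to $\mathcal{O}$ and outputs an optimal deviation vector, or reports that no feasible deviation vector exists.
   Context: An instance consists of: a finite ground set $S$ with $n=|S|$; a collection $\mathcal{F}\subseteq 2^S$ of feasible solutions of an underlying optimization problem; an input solution $F^*\in\mathcal{F}$; a positive integer $k$ and cost functions $c^1,\dots,c^k\in\mathbb{R}^S$, where $[k]=\{1,\dots,k\}$; a positive weight function $w\in\mathbb{R}_+^S$ (all $w(s)>0$), scaled so that $1/w(s)$ is an integer for each $s\in S$; and bounds $\ell\colon S\to\mathbb{R}\cup\{-\infty\}$, $u\colon S\to\mathbb{R}\cup\{+\infty\}$ with $\ell\le u$. Write $\|w\|_{-1}=\sum_{s\in S}\frac{1}{w(s)}$. For $x\in\mathbb{R}^S$ and $X\subseteq S$, $x(X)=\sum_{s\in X}x(s)$. A deviation vector $p\in\mathbb{R}^S$ is feasible if (a) for every $j\in[k]$, $F^*$ is a minimum-cost member of $\mathcal{F}$ with respect to $c^j-p$, i.e. $(c^j-p)(F^* )\le (c^j-p)(F)$ for all $F\in\mathcal{F}$, and (b) $\ell\le p\le u$ coordinatewise. It is optimal if it is feasible and minimizes,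 among feasible deviation vectors, $\|p\|_{\infty,w}=\max\{w(s)\cdot|p(s)|\mid s\in S\}$. The family $\mathcal{F}$ is accessed only through the oracle $\mathcal{O}$ (used as a black box), which, for any query $c'\in\mathbb{R}^S$, returns a member of $\mathcal{F}$ of minimum $c'$-cost; the other data are given explicitly. The algorithm is deterministic and may perform exact arithmetic and comparisons on real numbers. The constant in $O(k\cdot n\cdot\|w\|_{-1})$ is absolute (independent of the instance). *)

(* Defs.v *)
From HB Require Import structures.
From mathcomp Require Import all_boot all_order all_algebra.
From mathcomp Require Import constructive_ereal reals.

Set Implicit Arguments.
Unset Strict Implicit.
Unset Printing Implicit Defensive.

Import Order.TTheory GRing.Theory Num.Theory.
Local Open Scope ring_scope.

(* The part of an instance that is given explicitly.  The family of feasible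
   solutions is not part of it: it is only accessible through the oracle.
   Cost functions are indexed from 0. *)
Record input (R : realType) := Input {
  ground : finType;
  Fstar : {set ground};
  ncosts : nat;
  costs : 'I_ncosts -> ground -> R;
  weight : ground -> R;
  lower : ground -> \bar R;
  upper : ground -> \bar R
}.
Arguments costs {R} I j s : rename.
Arguments weight {R} I s : rename.
Arguments lower {R} I s : rename.
Arguments upper {R} I s : rename.

Record wf_input (R : realType) (I : input R) : Prop := WfInput {
  ncosts_gt0 : (0 < ncosts I)%N;
  weight_gt0 : forall s, 0 < weight I s;
  weightV_int : forall s, (weight I s)^-1 \is a Num.int;
  lower_npinfty : forall s, lower I s != +oo%E;
  upper_nninfty : forall s, upper I s != -oo%E;
  lower_le_upper : forall s, (lower I s <= upper I s)%E
}.

Definition cost (R : realType) (S : finType) (x : S -> R) (X : {set S}) : R :=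
  \sum_(s in X) x s.

Definition is_min_cost (R : realType) (S : finType) (FF : {set {set S}})
    (x : S -> R) (X : {set S}) : Prop :=
  X \in FF /\ (forall Y, Y \in FF -> cost x X <= cost x Y).

Definition is_oracle (R : realType) (S : finType) (FF : {set {set S}})
    (O : (S -> R) -> {set S}) : Prop :=
  forall x, is_min_cost FF x (O x).

Definition weightV_norm (R : realType) (I : input R) : R :=
  \sum_s (weight I s)^-1.

Definition feasible (R : realType) (I : input R) (FF : {set {set ground I}})
    (p : ground I -> R) : Prop :=
  (forall j, is_min_cost FF (fun s => costs I j s - p s) (Fstar I)) /\
  (forall s, (lower I s <= (p s)%:E <= upper I s)%E).

(* All the terms are nonnegative, so the default value 0 only matters for an
   empty ground set. *)
Definition winfty_norm (R : realType) (I : input R) (p : ground I -> R) : R :=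
  \big[Num.max/0]_s (weight I s * `|p s|).

Definition optimal (R : realType) (I : input R) (FF : {set {set ground I}})
    (p : ground I -> R) : Prop :=
  feasible FF p /\
  (forall p', feasible FF p' -> winfty_norm p <= winfty_norm p').

(* Algorithms are programs of a while language over a real RAM with an oracle
   instruction.  The store has natural number variables, used for control and
   indexing, and unbounded arrays of reals; variables and arrays are named by
   natural numbers.  A program is a finite syntactic object that mentions
   neither the instance nor any real constant except natural numbers. *)
Inductive nexp : Type :=
| NConst of nat
| NVar of nat
| NAdd of nexp & nexp
| NSub of nexp & nexp
| NMul of nexp & nexp.

Inductive rexp : Type :=
| RNat of nexp
| RCell of nat & nexp
| RAdd of rexp & rexp
| RSub of rexp & rexp
| RMul of rexp & rexp
| RDiv of rexp & rexp.

Inductive bexp : Type :=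
| BLtN of nexp & nexp
| BLtR of rexp & rexp
| BNot of bexp
| BAnd of bexp & bexp.

(* [Query a b] submits the cost vector stored in array [a] to the oracle and
   stores the 0/1 incidence vector of the answer in array [b]. *)
Inductive cmd : Type :=
| Skip
| AssignN of nat & nexp
| AssignR of nat & nexp & rexp
| Query of nat & nat
| Seq of cmd & cmd
| If of bexp & cmd & cmd
| While of bexp & cmd.

Record state (R : realType) := State {
  nvar : nat -> nat;
  arr : nat -> nat -> R
}.

Fixpoint neval (R : realType) (st : state R) (e : nexp) : nat :=
  match e with
  | NConst m => m
  | NVar x => nvar st x
  | NAdd e1 e2 => (neval st e1 + neval st e2)%N
  | NSub e1 e2 => (neval st e1 - neval st e2)%N
  | NMul e1 e2 => (neval st e1 * neval st e2)%N
  end.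

Fixpoint reval (R : realType) (st : state R) (e : rexp) : R :=
  match e with
  | RNat m => (neval st m)%:R
  | RCell a i => arr st a (neval st i)
  | RAdd e1 e2 => reval st e1 + reval st e2
  | RSub e1 e2 => reval st e1 - reval st e2
  | RMul e1 e2 => reval st e1 * reval st e2
  | RDiv e1 e2 => reval st e1 / reval st e2
  end.

Fixpoint beval (R : realType) (st : state R) (b : bexp) : bool :=
  match b with
  | BLtN e1 e2 => (neval st e1 < neval st e2)%N
  | BLtR e1 e2 => reval st e1 < reval st e2
  | BNot b1 => ~~ beval st b1
  | BAnd b1 b2 => beval st b1 && beval st b2
  end.

Definition set_nvar (R : realType) (st : state R) (x v : nat) : state R :=
  State [eta nvar st with x |-> v] (arr st).

Definition set_arr (R : realType) (st : state R) (a : nat) (f : nat -> R) :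
    state R :=
  State (nvar st) [eta arr st with a |-> f].

(* Vectors over the ground set are stored in the order of [enum S], in cells
   0 to #|S| - 1. *)
Definition vec_cells (R : realType) (S : finType) (x : S -> R) : nat -> R :=
  nth 0 [seq x s | s <- enum S].

Definition set_cells (R : realType) (S : finType) (X : {set S}) : nat -> R :=
  vec_cells (fun s : S => (s \in X)%:R).

Definition read_vec (R : realType) (S : finType) (st : state R) (a : nat) :
    S -> R :=
  fun s => arr st a (enum_rank s).

(* [exec O P st q st'] : from state [st], program [P] halts in state [st']
   after exactly [q] calls to the oracle [O]. *)
Inductive exec (R : realType) (S : finType) (O : (S -> R) -> {set S}) :
    cmd -> state R -> nat -> state R -> Prop :=
| ExecSkip st : exec O Skip st 0 st
| ExecAssignN st x e :
    exec O (AssignN x e) st 0 (set_nvar st x (neval st e))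
| ExecAssignR st a i e :
    exec O (AssignR a i e) st 0
      (set_arr st a [eta arr st a with neval st i |-> reval st e])
| ExecQuery st a b :
    exec O (Query a b) st 1 (set_arr st b (set_cells R (O (read_vec st a))))
| ExecSeq P1 P2 st st1 st2 q1 q2 :
    exec O P1 st q1 st1 -> exec O P2 st1 q2 st2 ->
    exec O (Seq P1 P2) st (q1 + q2) st2
| ExecIf b P1 P2 st st' q :
    exec O (if beval st b then P1 else P2) st q st' ->
    exec O (If b P1 P2) st q st'
| ExecWhileF b P st :
    ~~ beval st b -> exec O (While b P) st 0 st
| ExecWhileT b P st st1 st2 q1 q2 :
    beval st b -> exec O P st q1 st1 -> exec O (While b P) st1 q2 st2 ->
    exec O (While b P) st (q1 + q2) st2.

Lemma exec_deterministic (R : realType) (S : finType)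
    (O : (S -> R) -> {set S}) (P : cmd) (st : state R) (q1 q2 : nat)
    (st1 st2 : state R) :
  exec O P st q1 st1 -> exec O P st q2 st2 -> q1 = q2 /\ st1 = st2.
Proof.
move=> H; elim: H q2 st2 => {P st q1 st1}.
- by move=> st q2 st2 H; inversion H.
- by move=> st x e q2 st2 H; inversion H.
- by move=> st a i e q2 st2 H; inversion H.
- by move=> st a b q2 st2 H; inversion H.
- move=> P1 P2 st st1 st2 q1 q2 _ IH1 _ IH2 q st' H; inversion H; subst.
  match goal with K : exec O P1 _ _ _ |- _ => case: (IH1 _ _ K) => ? ? end.
  subst.
  by match goal with K : exec O P2 _ _ _ |- _ => case: (IH2 _ _ K) => -> -> end.
- by move=> b P1 P2 st st' q _ IH q2 st2 H; inversion H; subst; apply: IH.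
- move=> b P st nb q2 st2 H; inversion H; subst => //.
  by match goal with K : is_true (beval _ _) |- _ => rewrite K in nb end.
- move=> b P st st1 st2 q1 q2 tb _ IH1 _ IH2 q st' H; inversion H; subst.
    by match goal with K : is_true (~~ beval _ _) |- _ => rewrite tb in K end.
  match goal with K : exec O P _ _ _ |- _ => case: (IH1 _ _ K) => ? ? end.
  subst.
  by match goal with K : exec O (While b P) _ _ _ |- _ =>
    case: (IH2 _ _ K) => -> -> end.
Qed.

(* Arrays 2 to 5 encode each extended-real bound as its finite value together
   with a flag that is 1 when the bound is infinite; array 6 holds the cost
   functions in row-major order, the cost of the [i]-th element under the
   [j]-th function being in cell [j * #|ground I| + i]. *)
Definition init_state (R : realType) (I : input R) : state R :=
  State
    (fun x => match x with
      | 0%N => #|ground I|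
      | 1%N => ncosts I
      | _ => 0%N
      end)
    (fun a => match a with
      | 0%N => set_cells R (Fstar I)
      | 1%N => vec_cells (weight I)
      | 2%N => vec_cells (fun s => fine (lower I s))
      | 3%N => vec_cells (fun s => (lower I s == -oo%E)%:R)
      | 4%N => vec_cells (fun s => fine (upper I s))
      | 5%N => vec_cells (fun s => (upper I s == +oo%E)%:R)
      | 6%N => nth 0 [seq costs I j s | j <- enum 'I_(ncosts I), s <- enum (ground I)]
      | _ => fun=> 0
      end).

(* A halted program reports infeasibility by the value 0 of variable 2;
   otherwise its output vector is in array 7. *)
Definition output (R : realType) (I : input R) (st : state R) :
    option (ground I -> R) :=
  if nvar st 2 == 0%N then None else Some (read_vec st 7).

Definition correct_output (R : realType) (I : input R)
    (FF : {set {set ground I}}) (o : option (ground I -> R)) : Prop :=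
  match o with
  | Some p => optimal FF p
  | None => ~ (exists p, feasible FF p)
  end.

(* Main.v *)
Require Import Defs.
From HB Require Import structures.
From mathcomp Require Import all_boot all_order all_algebra.
From mathcomp Require Import constructive_ereal reals.
From mathcomp Require Import ring lra zify.

(** A parametrised Newton method.  On [Fstar] a large deviation helps and
    outside [Fstar] a small one does.  So among the vectors within the bounds
    and of norm at most [d] there is a best one, [dev d], with entries
    [min (u s) (d / w s)] on [Fstar] and [max (l s) (- d / w s)] elsewhere, and
    the task is to find the least radius [d], at least the one at which [dev d]
    fits the bounds, for which [dev d] is feasible.

    For a cost function [j] and a member [F] of the family, let
    [excess (resid j (dev d)) F] be the amount by which [Fstar] is costlier than
    [F].  As a function of [d] it is convex, nonincreasing and piecewise linear,
    and its slopes are, up to sign, sums of values [1 / w s], hence naturals at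
    most [W], the sum of all [1 / w s].  One query for the costs
    [resid j (dev d)] returns an [F] of maximal excess.
    - If the excess is not positive, [dev d] satisfies cost function [j], and
      it still does at larger radii ([excess_dev_le]).
    - If it is positive with slope 0, no radius helps.
    - Otherwise every feasible vector has norm at least the zero of the tangent
      at [d] ([feasible_tangent]), and [d] moves there.

    The radius is therefore always a lower bound on the optimum, and it is the
    optimum once all cost functions are satisfied.  While [j] is fixed the
    slopes decrease strictly from one Newton step to the next
    ([newton_slope_lt]), so [j] costs at most [W + 1] queries, and all cost
    functions together cost at most [k * (W + 1) <= 2 * k * n * W] when the
    ground set is nonempty, since then [W >= 1].  An empty ground set requires no
    query.

    The program is verified by a frame property (what a program does not assign
    it does not change), by evaluation of straight-line code, and by one rule
    for loops over the ground set. *)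

Set Implicit Arguments.
Unset Strict Implicit.
Unset Printing Implicit Defensive.

Import Order.TTheory GRing.Theory Num.Theory.
Local Open Scope ring_scope.

(** * The extremal deviation of a given size *)

Section ExtremalDeviation.
Variables (R : realType) (I : input R).
Hypothesis Iwf : wf_input I.
Implicit Types (s : ground I) (F : {set ground I}) (p x : ground I -> R).

Definition sgn s : R := if s \in Fstar I then 1 else -1.

(** The upper bound on [sgn s * p s], split into a flag for an infinite bound
    and a finite value, as in the input format. *)
Definition cap_infinite s : bool :=
  if s \in Fstar I then upper I s == +oo%E else lower I s == -oo%E.
Definition cap s : R :=
  if s \in Fstar I then fine (upper I s) else - fine (lower I s).

Definition capped (d : R) s : bool :=
  ~~ cap_infinite s && ~~ (d / weight I s < cap s).

Definition dev (d : R) s : R :=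
  sgn s * (if capped d s then cap s else d / weight I s).

(** The right derivative of [sgn s * dev d s] with respect to [d]. *)
Definition rate (d : R) s : R :=
  if capped d s then 0 else (weight I s)^-1.

(** Its sign is [sgn s] on the symmetric difference of [Fstar] and [F]; this
    reduces both parts of that difference to one case. *)
Definition incid_diff F s : R := (s \in Fstar I)%:R - (s \in F)%:R.

Definition excess x F : R := \sum_s incid_diff F s * x s.

(** Minus the right derivative in [d] of [excess (resid j (dev d)) F]. *)
Definition slope (d : R) F : R := \sum_s incid_diff F s ^+ 2 * rate d s.

Definition resid (j : 'I_(ncosts I)) (p : ground I -> R) s : R :=
  costs I j s - p s.

(** The values of [d] for which the intervals [`[- d / w s, d / w s]] and
    [`[lower s, upper s]] meet for all [s]; the default value 0 of [fine] at
    the infinities is harmless because [0 <= d]. *)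
Definition radius_ok (d : R) : Prop :=
  0 <= d /\ forall s, weight I s * fine (lower I s) <= d /\
                      - (weight I s * fine (upper I s)) <= d.

Definition within_bounds p : Prop :=
  forall s, (lower I s <= (p s)%:E <= upper I s)%E.

Lemma costE x F : cost x F = \sum_s (s \in F)%:R * x s.
Proof.
rewrite /cost big_mkcond; apply: eq_bigr => s _.
by case: (s \in F); rewrite ?mul1r ?mul0r.
Qed.

Lemma excessE x F : excess x F = cost x (Fstar I) - cost x F.
Proof.
rewrite !costE -sumrB; apply: eq_bigr => s _.
by rewrite /incid_diff mulrBl.
Qed.

Lemma eq_excess x y F : x =1 y -> excess x F = excess y F.
Proof. by move=> xy; apply: eq_bigr => s _; rewrite xy. Qed.

Lemma incid_diff_sqr F s :
  incid_diff F s ^+ 2 = ((s \in Fstar I) (+) (s \in F))%:R.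
Proof.
by rewrite /incid_diff; case: (s \in Fstar I); case: (s \in F) => /=; ring.
Qed.

Lemma incid_diff_sgn F s : incid_diff F s = incid_diff F s ^+ 2 * sgn s.
Proof.
by rewrite /incid_diff /sgn; case: (s \in Fstar I); case: (s \in F) => /=; ring.
Qed.

Lemma excess_resid_diff j p p' F :
  excess (resid j p') F - excess (resid j p) F =
  - (\sum_s incid_diff F s ^+ 2 * (sgn s * (p' s - p s))).
Proof.
rewrite /excess -sumrB -sumrN; apply: eq_bigr => s _.
by rewrite mulrA -incid_diff_sgn /resid; ring.
Qed.

(** Comparing two deviation vectors entrywise against [rate] compares their
    excesses against [slope]; a negative [t] is allowed. *)
Lemma excess_resid_ge j (d t : R) p p' F :
    (forall s, sgn s * (p' s - p s) <= t * rate d s) ->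
  excess (resid j p) F - t * slope d F <= excess (resid j p') F.
Proof.
move=> H; have := excess_resid_diff j p p' F.
have : \sum_s incid_diff F s ^+ 2 * (sgn s * (p' s - p s)) <= t * slope d F.
  rewrite /slope mulr_sumr; apply: ler_sum => s _.
  by rewrite [leRHS]mulrCA; apply: ler_wpM2l => //; apply: sqr_ge0.
lra.
Qed.

Lemma sgn_sqr s : sgn s * sgn s = 1.
Proof. by rewrite /sgn; case: ifP => _; ring. Qed.

Lemma sgn_dev d s :
  sgn s * dev d s = if capped d s then cap s else d / weight I s.
Proof. by rewrite /dev mulrA sgn_sqr mul1r. Qed.

(** [sgn s * dev d s] is the minimum of a constant and a linear function of
    [d], hence concave: its chords are at least as steep as its right
    derivative at their right end. *)
Lemma dev_growth d d' s :
  d <= d' -> (d' - d) * rate d' s <= sgn s * (dev d' s - dev d s).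
Proof.
move=> dd'; rewrite mulrBr !sgn_dev /rate /capped.
have w0 : 0 < (weight I s)^-1 by rewrite invr_gt0 weight_gt0.
have : d / weight I s <= d' / weight I s by rewrite ler_pM2r.
case: (cap_infinite s) => /=; first by rewrite mulrBl.
case: ltP => ?; case: ltP => ?; rewrite ?mulr0 /=; lra.
Qed.

Lemma rate_ge0 d s : 0 <= rate d s.
Proof.
by rewrite /rate; case: ifP => _ //; rewrite invr_ge0 ltW // weight_gt0.
Qed.

Lemma weight_norm_le p s : `|p s| <= winfty_norm p / weight I s.
Proof.
rewrite ler_pdivlMr ?weight_gt0 // mulrC /winfty_norm.
exact: (le_bigmax _ (fun s => weight I s * `|p s|)).
Qed.

(** A vector within the bounds exceeds [dev d] on [Fstar], and falls below it
    elsewhere, only where the bound is not yet reached, and there only by its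
    surplus in norm. *)
Lemma dev_dominates d p s : within_bounds p ->
  sgn s * (p s - dev d s) <= (winfty_norm p - d) * rate d s.
Proof.
move=> /(_ s) /andP[lp pu]; rewrite mulrBr sgn_dev /rate /capped.
have wn := weight_norm_le p s.
have sp : sgn s * p s <= winfty_norm p / weight I s.
  apply: le_trans wn; rewrite /sgn; case: ifP => _.
    by rewrite mul1r ler_norm.
  by rewrite mulN1r -normrN ler_norm.
case ci : (cap_infinite s) => /=; first by rewrite mulrBl lerB.
case: ltP => _ /=; first by rewrite mulrBl lerB.
rewrite mulr0 subr_le0.
move: ci; rewrite /cap_infinite /cap /sgn; case: ifP => _ ci.
  have := upper_nninfty Iwf s; move: ci pu.
  by case: (upper I s) => // u _; rewrite lee_fin mul1r.
have := lower_npinfty Iwf s; move: ci lp.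
by case: (lower I s) => // l _; rewrite lee_fin mulN1r lerN2.
Qed.

Lemma radius_ok_le d d' : radius_ok d -> d <= d' -> radius_ok d'.
Proof.
move=> [d0 dP] dd'; split=> [|s]; first exact: le_trans dd'.
by have [? ?] := dP s; split; apply: le_trans dd'.
Qed.

Lemma radius_le_norm p s : within_bounds p ->
  weight I s * fine (lower I s) <= winfty_norm p /\
  - (weight I s * fine (upper I s)) <= winfty_norm p.
Proof.
move=> /(_ s) /andP[lp pu].
have w0 : 0 < weight I s by exact: weight_gt0.
have : weight I s * `|p s| <= winfty_norm p.
  exact: (le_bigmax _ (fun s => weight I s * `|p s|)).
have n0 : 0 <= winfty_norm p by exact: bigmax_ge_id.
have p1 : weight I s * p s <= weight I s * `|p s|.
  by rewrite ler_pM2l // ler_norm.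
have p2 : - (weight I s * p s) <= weight I s * `|p s|.
  by rewrite -mulrN ler_pM2l // -normrN ler_norm.
split.
  move: lp; case: (lower I s) => [l| |] /=; rewrite ?mulr0 // lee_fin => {}lp.
  have : weight I s * l <= weight I s * p s by rewrite ler_pM2l.
  lra.
move: pu; case: (upper I s) => [l| |] /=; rewrite ?mulr0 ?oppr0 // lee_fin => {}pu.
have : weight I s * p s <= weight I s * l by rewrite ler_pM2l.
lra.
Qed.

Lemma norm_dev d : radius_ok d -> winfty_norm (dev d) <= d.
Proof.
move=> [d0 dP]; apply: bigmax_le => // s _; have [dl du] := dP s.
have w0 : 0 < weight I s by exact: weight_gt0.
rewrite mulrC -ler_pdivlMr //.
have -> : `|dev d s| = `|sgn s * dev d s|.
  by rewrite [RHS]normrM /sgn; case: ifP => _; rewrite ?normrN1 ?normr1 mul1r.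
have dw : 0 <= d / weight I s by rewrite divr_ge0 // ltW.
rewrite sgn_dev; case: ifP => [|_]; last by rewrite ger0_norm.
rewrite /capped -leNgt => /andP[_ cd]; rewrite ler_norml cd andbT.
rewrite lerNl ler_pdivlMr // mulrC; move: du dl.
by rewrite /cap; case: ifP => _; rewrite ?mulrN ?opprK.
Qed.

Lemma dev_within_bounds d : radius_ok d -> within_bounds (dev d).
Proof.
move=> [d0 dP] s; have [dl du] := dP s.
have w0 : 0 < weight I s by exact: weight_gt0.
have lw : fine (lower I s) <= d / weight I s by rewrite ler_pdivlMr // mulrC.
have uw : - (d / weight I s) <= fine (upper I s).
  by rewrite lerNl ler_pdivlMr // mulrC mulrN.
have := lower_npinfty Iwf s; have := upper_nninfty Iwf s.
have := lower_le_upper Iwf s; move: lw uw.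
rewrite /dev /sgn /capped /cap_infinite /cap; case: (s \in Fstar I).
  case: (upper I s) => [u| |] //; case: (lower I s) => [l| |] //=;
    rewrite ?mul1r ?leey ?leNye ?lee_fin ?andbT // => lw uw lu _ _;
    case: ltP => ? /=; rewrite ?lw ?lu //=; exact: ltW.
case: (upper I s) => [u| |] //; case: (lower I s) => [l| |] //=;
  rewrite ?mulN1r ?leey ?leNye ?lee_fin ?andbT // => lw uw lu _ _;
  try case: ltP => /= ?; rewrite ?opprK ?lexx ?lu ?uw ?andbT //=; lra.
Qed.

(** * Newton steps *)

(** The excess is a convex function of the radius, with right derivative
    [- slope d' F] at [d']: this is its supporting line there. *)
Lemma excess_dev_tangent j d d' F : d <= d' ->
  excess (resid j (dev d')) F + (d' - d) * slope d' F <=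
  excess (resid j (dev d)) F.
Proof.
move=> dd'; rewrite -[X in _ + X]opprK -mulNr; apply: excess_resid_ge => s.
by have := dev_growth s dd'; lra.
Qed.

Lemma slope_ge0 d F : 0 <= slope d F.
Proof.
by apply: sumr_ge0 => s _; rewrite mulr_ge0 ?rate_ge0 // sqr_ge0.
Qed.

Lemma excess_dev_le j d d' F : d <= d' ->
  excess (resid j (dev d')) F <= excess (resid j (dev d)) F.
Proof.
move=> dd'; apply: le_trans (excess_dev_tangent j F dd').
by rewrite lerDl mulr_ge0 ?slope_ge0 // subr_ge0.
Qed.

Lemma slope_nat d F : exists m : nat, slope d F = m%:R.
Proof.
apply/natrP; apply: rpred_sum => s _; apply: rpredM.
  by rewrite incid_diff_sqr rpred_nat.
rewrite /rate; case: ifP => _; first exact: rpred0.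
by rewrite natrEint weightV_int // invr_ge0 ltW // weight_gt0.
Qed.

Lemma slope_le d F : slope d F <= weightV_norm I.
Proof.
apply: ler_sum => s _; rewrite -[leRHS]mul1r.
apply: ler_pM; rewrite ?sqr_ge0 ?rate_ge0 //.
  by rewrite incid_diff_sqr; case: (_ (+) _).
by rewrite /rate; case: ifP => // _; rewrite invr_ge0 ltW // weight_gt0.
Qed.

Lemma weightV_normP :
  exists2 m : nat, weightV_norm I = m%:R & ((0 < #|ground I|) <= m)%N.
Proof.
have nonneg s : 0 <= (weight I s)^-1 by rewrite invr_ge0 ltW // weight_gt0.
have /natrP[m mE] : weightV_norm I \is a Num.nat.
  by apply: rpred_sum => s _; rewrite natrEint weightV_int ?nonneg.
exists m => //; case: posnP => // n0; rewrite -(ltr0n R) -mE.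
case/card_gt0P: n0 => s _.
rewrite /weightV_norm (bigD1 s) //= ltr_pwDl ?invr_gt0 ?weight_gt0 //.
exact: sumr_ge0.
Qed.

(** From [d] to [d'] the excess of [F'] drops from at most [f] to more than 0,
    hence by less than [f] over a distance [f / slope d F]; by convexity its
    slope at the end of that interval is at most its average slope there. *)
Lemma newton_slope_lt j d F F' (f := excess (resid j (dev d)) F)
    (d' := d + f / slope d F) :
    0 < f -> 0 < slope d F -> excess (resid j (dev d)) F' <= f ->
    0 < excess (resid j (dev d')) F' ->
  slope d' F' < slope d F.
Proof.
move=> f0 g0 F'f F'0; have q0 : 0 < f / slope d F by rewrite divr_gt0.
have dd' : d <= d' by rewrite lerDl ltW.
have := excess_dev_tangent j F' dd'.
have -> : d' - d = f / slope d F by rewrite /d' addrC addKr.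
move=> T.
have : f / slope d F * slope d' F' < f by lra.
by rewrite mulrAC ltr_pdivrMr // ltr_pM2l.
Qed.

Section Feasibility.
Variable FF : {set {set ground I}}.
Hypothesis FstarFF : Fstar I \in FF.

Lemma feasibleE p :
  feasible FF p <->
  within_bounds p /\ forall j F, F \in FF -> excess (resid j p) F <= 0.
Proof.
split=> [[mc bd]|[bd ex]]; split=> //.
  by move=> j F FFF; rewrite excessE subr_le0; have [_] := mc j; apply.
by move=> j; split=> // F FFF; rewrite -subr_le0 -excessE; apply: ex.
Qed.

(** A feasible vector of norm [N] makes the excess of [F] nonpositive, and
    [dev N] does at least as well; so [N] is beyond the zero of the tangent. *)
Lemma feasible_tangent j d F p : F \in FF -> feasible FF p ->
  excess (resid j (dev d)) F <= (winfty_norm p - d) * slope d F.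
Proof.
move=> FFF /feasibleE[bd /(_ j F FFF)].
by have := excess_resid_ge j F (fun s => dev_dominates d s bd); lra.
Qed.

End Feasibility.

End ExtremalDeviation.

(** * Reasoning about programs *)

Section Programs.
Variables (R : realType) (S : finType) (O : (S -> R) -> {set S}).
Implicit Types (st : state R) (P body : cmd).

Fixpoint assigned_vars P : seq nat :=
  match P with
  | AssignN x _ => [:: x]
  | Seq P1 P2 | If _ P1 P2 => assigned_vars P1 ++ assigned_vars P2
  | While _ P1 => assigned_vars P1
  | _ => [::]
  end.

Fixpoint assigned_arrays P : seq nat :=
  match P with
  | AssignR a _ _ => [:: a]
  | Query _ b => [:: b]
  | Seq P1 P2 | If _ P1 P2 => assigned_arrays P1 ++ assigned_arrays P2
  | While _ P1 => assigned_arrays P1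
  | _ => [::]
  end.

Lemma exec_nvar_frame P st q st' x :
  exec O P st q st' -> x \notin assigned_vars P -> nvar st' x = nvar st x.
Proof.
elim=> //= {P st q st'}.
- by move=> st y e; rewrite inE => /negPf ->.
- move=> P1 P2 st st1 st2 q1 q2 _ IH1 _ IH2.
  by rewrite mem_cat negb_or => /andP[/IH1 <- /IH2].
- move=> b P1 P2 st st' q _ IH; rewrite mem_cat negb_or => /andP[x1 x2].
  by apply: IH; case: (beval st b).
- by move=> b P st st1 st2 q1 q2 _ _ IH1 _ IH2 xP; rewrite IH2 ?IH1.
Qed.

Lemma exec_arr_frame P st q st' a :
  exec O P st q st' -> a \notin assigned_arrays P -> arr st' a = arr st a.
Proof.
elim=> //= {P st q st'}.
- by move=> st b i e; rewrite inE => /negPf ->.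
- by move=> st b c; rewrite inE => /negPf ->.
- move=> P1 P2 st st1 st2 q1 q2 _ IH1 _ IH2.
  by rewrite mem_cat negb_or => /andP[/IH1 <- /IH2].
- move=> b P1 P2 st st' q _ IH; rewrite mem_cat negb_or => /andP[x1 x2].
  by apply: IH; case: (beval st b).
- by move=> b P st st1 st2 q1 q2 _ _ IH1 _ IH2 xP; rewrite IH2 ?IH1.
Qed.

Fixpoint straightline P : bool :=
  match P with
  | Query _ _ | While _ _ => false
  | Seq P1 P2 | If _ P1 P2 => straightline P1 && straightline P2
  | _ => true
  end.

(** The final state as a function of the initial one, so that the effect of a
    straight-line program is found by computation. *)
Fixpoint run P st : state R :=
  match P with
  | AssignN x e => set_nvar st x (neval st e)
  | AssignR a i e => set_arr st a [eta arr st a with neval st i |-> reval st e]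
  | Seq P1 P2 => run P2 (run P1 st)
  | If b P1 P2 => if beval st b then run P1 st else run P2 st
  | _ => st
  end.

Lemma exec_run P st : straightline P -> exec O P st 0 (run P st).
Proof.
elim: P st => //=.
- by move=> st _; apply: ExecSkip.
- by move=> x e st _; apply: ExecAssignN.
- by move=> a i e st _; apply: ExecAssignR.
- move=> P1 IH1 P2 IH2 st /andP[s1 s2].
  by rewrite -[0%N]addn0; apply: ExecSeq; [apply: IH1|apply: IH2].
- move=> b P1 IH1 P2 IH2 st /andP[s1 s2]; apply: ExecIf.
  by case: (beval st b); [apply: IH1|apply: IH2].
Qed.

Definition for_upto (x y : nat) body : cmd :=
  Seq (AssignN x (NConst 0))
    (While (BLtN (NVar x) (NVar y))
       (Seq body (AssignN x (NAdd (NVar x) (NConst 1))))).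

(** The invariant speaks of the arrays only: the loop body changes no variable,
    so the values of the variables are known in every iteration. *)
Lemma exec_for (Inv : nat -> (nat -> nat -> R) -> Prop) x y body st :
    x != y -> straightline body -> assigned_vars body = [::] ->
    Inv 0%N (arr st) ->
    (forall i st1, (i < nvar st y)%N -> nvar st1 x = i ->
       (forall z, z != x -> nvar st1 z = nvar st z) ->
       (forall a, a \notin assigned_arrays body -> arr st1 a = arr st a) ->
       Inv i (arr st1) -> Inv i.+1 (arr (run body st1))) ->
  exists2 st', exec O (for_upto x y body) st 0 st' & Inv (nvar st y) (arr st').
Proof.
move=> xy sb vb I0 Istep.
pose b := BLtN (NVar x) (NVar y).
pose body' := Seq body (AssignN x (NAdd (NVar x) (NConst 1))).
suff loop m i st1 : (i + m = nvar st y)%N -> nvar st1 x = i ->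
    (forall z, z != x -> nvar st1 z = nvar st z) ->
    (forall a, a \notin assigned_arrays body -> arr st1 a = arr st a) ->
    Inv i (arr st1) ->
  exists2 st', exec O (While b body') st1 0 st' & Inv (nvar st y) (arr st').
  have [|||//||st' ex Ist'] := loop (nvar st y) 0%N (set_nvar st x 0).
  - by rewrite add0n.
  - by rewrite /= eqxx.
  - by move=> z /negPf /= ->.
  - by [].
  exists st' => //; rewrite -[0%N]addn0.
  by apply: ExecSeq ex; apply: ExecAssignN.
elim: m i st1 => [|m IH] i st1 im st1x st1v st1a Ii.
  exists st1; last by rewrite -im addn0.
  by apply: ExecWhileF; rewrite /= st1x st1v 1?eq_sym // -im addn0 ltnn.
have exb := exec_run st1 sb.
have runv z : nvar (run body st1) z = nvar st1 z.
  by apply: exec_nvar_frame exb _; rewrite vb.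
pose st2 := set_nvar (run body st1) x i.+1.
have ex2 : exec O body' st1 (0 + 0) st2.
  apply: ExecSeq exb _; rewrite /st2.
  have -> : i.+1 = neval (run body st1) (NAdd (NVar x) (NConst 1)).
    by rewrite /= runv st1x addn1.
  exact: ExecAssignN.
have iy : (i < nvar st y)%N by rewrite -im addnS ltnS leq_addr.
have [|||||st' ex' I'] := IH i.+1 st2.
- by rewrite addSnnS.
- by rewrite /= eqxx.
- by move=> z zx; rewrite /= (negPf zx) runv st1v.
- by move=> a ab; rewrite -(st1a a ab); apply: exec_arr_frame exb ab.
- exact: Istep iy st1x st1v st1a Ii.
exists st' => //; rewrite -[0%N]/(0 + 0 + 0)%N.
by apply: ExecWhileT ex2 ex'; rewrite /= st1x st1v // eq_sym.
Qed.

End Programs.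

(** * The program *)

(** Variables: 0 and 1 hold the sizes of the ground set and of the family of
    cost functions, 2 the answer flag, 3 the current cost function and 4 the
    loop index.  Arrays: 0 to 6 hold the input, 7 the deviation vector, 8 the
    query, 9 the answer of the oracle, 13 the rates; cell 0 of arrays 10, 11
    and 12 holds the current radius, the excess and the slope. *)

Definition num (m : nat) : rexp := RNat (NConst m).
Definition scalar (a : nat) : rexp := RCell a (NConst 0).
Definition entry (a : nat) : rexp := RCell a (NVar 4).
Definition set_scalar (a : nat) (e : rexp) : cmd := AssignR a (NConst 0) e.
Definition set_entry (a : nat) (e : rexp) : cmd := AssignR a (NVar 4) e.
Definition for_ground : cmd -> cmd := for_upto 4 0.

Definition low_radius_exp : rexp := RMul (entry 1) (entry 2).
Definition high_radius_exp : rexp := RSub (num 0) (RMul (entry 1) (entry 4)).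
Definition raise_radius (e : rexp) : cmd :=
  If (BLtR (scalar 10) e) (set_scalar 10 e) Skip.
Definition radius_body : cmd :=
  Seq (raise_radius low_radius_exp) (raise_radius high_radius_exp).

(** Membership in [Fstar] is stored as 0 or 1, so a choice between two values
    is a convex combination. *)
Definition sgn_exp : rexp := RSub (RMul (num 2) (entry 0)) (num 1).
Definition cap_exp : rexp :=
  RSub (RMul (entry 0) (entry 4)) (RMul (RSub (num 1) (entry 0)) (entry 2)).
Definition cap_infinite_exp : rexp :=
  RAdd (RMul (entry 0) (entry 5)) (RMul (RSub (num 1) (entry 0)) (entry 3)).
Definition ratio_exp : rexp := RDiv (scalar 10) (entry 1).
Definition capped_exp : bexp :=
  BAnd (BNot (BLtR (num 0) cap_infinite_exp)) (BNot (BLtR ratio_exp cap_exp)).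
Definition dev_body : cmd :=
  Seq (If capped_exp
         (Seq (set_entry 7 (RMul sgn_exp cap_exp)) (set_entry 13 (num 0)))
         (Seq (set_entry 7 (RMul sgn_exp ratio_exp))
              (set_entry 13 (RDiv (num 1) (entry 1)))))
      (set_entry 8
         (RSub (RCell 6 (NAdd (NMul (NVar 3) (NVar 0)) (NVar 4))) (entry 7))).

Definition incid_diff_exp : rexp := RSub (entry 0) (entry 9).
Definition sums_body : cmd :=
  Seq (set_scalar 11 (RAdd (scalar 11) (RMul incid_diff_exp (entry 8))))
      (set_scalar 12
         (RAdd (scalar 12)
            (RMul (RMul incid_diff_exp incid_diff_exp) (entry 13)))).
Definition measure_answer : cmd :=
  Seq (set_scalar 11 (num 0))
    (Seq (set_scalar 12 (num 0)) (for_ground sums_body)).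

Definition newton_update : cmd :=
  If (BLtR (num 0) (scalar 11))
    (If (BLtR (num 0) (scalar 12))
       (set_scalar 10 (RAdd (scalar 10) (RDiv (scalar 11) (scalar 12))))
       (Seq (AssignN 2 (NConst 0)) (AssignN 3 (NVar 1))))
    (AssignN 3 (NAdd (NVar 3) (NConst 1))).
Definition newton_step : cmd :=
  Seq (for_ground dev_body) (Seq (Query 8 9) (Seq measure_answer newton_update)).
(** On an empty ground set no query is affordable, as the bound is then 0. *)
Definition newton_guard : bexp :=
  BAnd (BLtN (NVar 3) (NVar 1)) (BLtN (NConst 0) (NVar 0)).

(** Recomputing the deviation vector after the loop determines array 7 without
    any help from the loop invariant. *)
Definition newton : cmd :=
  Seq (AssignN 2 (NConst 1))
    (Seq (for_ground radius_body)
       (Seq (While newton_guard newton_step) (for_ground dev_body))).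


(** * The effect of the program *)

Section Cells.
Variables (R : realType) (I : input R) (O : (ground I -> R) -> {set ground I}).
Implicit Types (s : ground I) (st : state R).

Lemma vec_cellsE (x : ground I -> R) s : vec_cells x (enum_rank s) = x s.
Proof.
by rewrite /vec_cells (nth_map s) ?nth_enum_rank // -cardE.
Qed.

Lemma nth_allpairs (A B C : Type) (f : A -> B -> C) a0 b0 c0 (r : seq A) (t : seq B) i j :
    (i < size r)%N -> (j < size t)%N ->
  nth c0 [seq f a b | a <- r, b <- t] (i * size t + j) =
  f (nth a0 r i) (nth b0 t j).
Proof.
move=> + jt; elim: r i => // a r IH [|i] ir.
  by rewrite /= nth_cat size_map mul0n jt (nth_map b0).
rewrite /= nth_cat size_map mulSn -addnA ltnNge leq_addr addKn /=.
exact: IH.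
Qed.

Definition holds_input st : Prop :=
  [/\ nvar st 0 = #|ground I|, nvar st 1 = ncosts I
    & forall a, (a < 7)%N -> arr st a = arr (init_state I) a].

Lemma holds_input_frame P st q st' :
    holds_input st -> exec O P st q st' ->
    0%N \notin assigned_vars P -> 1%N \notin assigned_vars P ->
    all (leq 7) (assigned_arrays P) ->
  holds_input st'.
Proof.
move=> [v0 v1 ar] ex P0 P1 /allP Pa; split.
- by rewrite (exec_nvar_frame ex).
- by rewrite (exec_nvar_frame ex).
- move=> a a7; rewrite (exec_arr_frame ex) ?ar //.
  by apply: contraTN a7 => /Pa; rewrite -leqNgt.
Qed.

Section Entries.
Variables (st : state R) (s : ground I).
Hypotheses (sti : holds_input st) (st4 : nvar st 4 = enum_rank s).

Let input_cell a : (a < 7)%N ->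
  arr st a (enum_rank s) = arr (init_state I) a (enum_rank s).
Proof. by case: sti => _ _ ar a7; rewrite ar. Qed.

Lemma Fstar_cell : arr st 0%N (enum_rank s) = (s \in Fstar I)%:R.
Proof. by rewrite input_cell //= /set_cells vec_cellsE. Qed.

Lemma weight_cell : arr st 1%N (enum_rank s) = weight I s.
Proof. by rewrite input_cell //= vec_cellsE. Qed.

Lemma cost_cell (j : 'I_(ncosts I)) :
  arr st 6%N (j * #|ground I| + enum_rank s) = costs I j s.
Proof.
case: sti => _ _ -> //=.
have -> : (j * #|ground I| = j * size (enum (ground I)))%N by rewrite -cardE.
rewrite (nth_allpairs _ j s) -?cardE ?card_ord ?ltn_ord //.
by rewrite nth_ord_enum nth_enum_rank.
Qed.

Lemma reval_low_radius :
  reval st low_radius_exp = weight I s * fine (lower I s).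
Proof.
by rewrite /low_radius_exp /= st4 weight_cell input_cell //= vec_cellsE.
Qed.

Lemma reval_high_radius :
  reval st high_radius_exp = - (weight I s * fine (upper I s)).
Proof.
by rewrite /high_radius_exp /= st4 weight_cell input_cell //= vec_cellsE sub0r.
Qed.

Lemma reval_sgn : reval st sgn_exp = sgn s.
Proof.
by rewrite /sgn_exp /= st4 Fstar_cell /sgn; case: (s \in _) => /=; ring.
Qed.

Lemma reval_cap : reval st cap_exp = cap s.
Proof.
rewrite /cap_exp /= st4 Fstar_cell !input_cell //= !vec_cellsE /cap.
by case: (s \in _) => /=; ring.
Qed.

Lemma reval_ratio : reval st ratio_exp = arr st 10 0 / weight I s.
Proof. by rewrite /ratio_exp /= st4 weight_cell. Qed.

Lemma beval_capped : beval st capped_exp = capped (arr st 10 0) s.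
Proof.
rewrite /capped -reval_cap -reval_ratio /cap_infinite /=.
congr (~~ _ && _); rewrite st4 Fstar_cell !input_cell //= !vec_cellsE.
by case: (s \in _); rewrite ?subr0 ?subrr ?mul1r ?mul0r ?addr0 ?add0r ltr0n lt0b.
Qed.

End Entries.

(* Simplification must keep these expressions folded, so that the lemmas above
   can rewrite their values. *)
#[local] Opaque low_radius_exp high_radius_exp sgn_exp cap_exp ratio_exp.
#[local] Opaque capped_exp.

(** Every index below [#|ground I|] is the rank of a ground element, so a loop
    over the indices is a loop over the ground set. *)
Lemma exec_for_ground (Inv : nat -> (nat -> nat -> R) -> Prop) body st :
    holds_input st -> straightline body -> assigned_vars body = [::] ->
    all (leq 7) (assigned_arrays body) ->
    Inv 0%N (arr st) ->
    (forall s st1, holds_input st1 -> nvar st1 4 = enum_rank s ->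
       nvar st1 3 = nvar st 3 ->
       (forall a, a \notin assigned_arrays body -> arr st1 a = arr st a) ->
       Inv (enum_rank s) (arr st1) ->
       Inv (enum_rank s).+1 (arr (run body st1))) ->
  exists2 st', exec O (for_ground body) st 0 st' & Inv #|ground I| (arr st').
Proof.
move=> sti sb vb ab I0 Istep; have [v0 v1 ar] := sti; rewrite -v0.
apply: exec_for => // i st1; rewrite v0 => iS st1x st1v st1a.
have <- : enum_rank (enum_val (Ordinal iS)) = i :> nat by rewrite enum_valK.
apply: Istep; rewrite ?enum_valK //; last by rewrite st1v.
split; rewrite ?st1v // => a a7; rewrite st1a ?ar //.
by apply: contraTN a7 => /(allP ab); rewrite -leqNgt.
Qed.

(** The least radius at which the boxes meet is a maximum of lower bounds on
    the norm of every vector within the bounds. *)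
Lemma exec_radius st : wf_input I -> holds_input st -> arr st 10 0 = 0 ->
  exists2 st', exec O (for_ground radius_body) st 0 st' &
    radius_ok I (arr st' 10 0) /\
    forall p : ground I -> R, within_bounds p -> arr st' 10 0 <= winfty_norm p.
Proof.
move=> Iwf sti st0.
pose Inv i (A : nat -> nat -> R) :=
  [/\ 0 <= A 10%N 0%N,
      forall s, (enum_rank s < i)%N ->
        weight I s * fine (lower I s) <= A 10%N 0%N /\
        - (weight I s * fine (upper I s)) <= A 10%N 0%N
    & forall p : ground I -> R, within_bounds p -> A 10%N 0%N <= winfty_norm p].
have [||||||st' ex [i1 i2 i3]] := @exec_for_ground Inv radius_body st => //.
- by rewrite /Inv st0; split=> // p _; apply: bigmax_ge_id.
- move=> s st1 st1i st14 _ _ [A0 Alu An].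
  have body_run : arr (run radius_body st1) 10 0 = Num.max
      (Num.max (arr st1 10 0) (weight I s * fine (lower I s)))
      (- (weight I s * fine (upper I s))).
    have run_raise e st2 : arr (run (raise_radius e) st2) 10 0 =
        Num.max (arr st2 10 0) (reval st2 e).
      by rewrite /= /Order.max; case: ifP.
    have ex2 := exec_run O st1 (isT : straightline (raise_radius low_radius_exp)).
    have st2i := holds_input_frame st1i ex2 isT isT isT.
    rewrite -[run radius_body st1]/(run (raise_radius high_radius_exp)
      (run (raise_radius low_radius_exp) st1)).
    have st24 : nvar (run (raise_radius low_radius_exp) st1) 4 = enum_rank s.
      by rewrite (exec_nvar_frame ex2).
    rewrite run_raise (reval_high_radius st2i st24).
    by rewrite run_raise (reval_low_radius st1i st14).
  rewrite /Inv body_run; split.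
  - by rewrite !le_max A0.
  - move=> t; rewrite ltnS leq_eqVlt => /orP[/eqP/val_inj/enum_rank_inj->|ts].
      by rewrite !le_max !lexx !orbT.
    by have [? ?] := Alu t ts; rewrite !le_max; split; apply/orP; left; apply/orP; left.
  - move=> p pb; have [? ?] := radius_le_norm Iwf s pb.
    by rewrite !ge_max An //; apply/andP.
exists st' => //; split=> //; split=> // s; exact: i2 (ltn_ord _).
Qed.

Lemma exec_dev st : holds_input st ->
  exists2 st', exec O (for_ground dev_body) st 0 st' &
    forall s, [/\ arr st' 7 (enum_rank s) = dev (arr st 10 0) s,
      arr st' 13 (enum_rank s) = rate (arr st 10 0) s
      & forall j : 'I_(ncosts I), nvar st 3 = j ->
          arr st' 8 (enum_rank s) = resid j (dev (arr st 10 0)) s].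
Proof.
move=> sti; set d := arr st 10 0.
pose Inv i (A : nat -> nat -> R) := forall s, (enum_rank s < i)%N ->
  [/\ A 7%N (enum_rank s) = dev d s, A 13%N (enum_rank s) = rate d s
    & forall j : 'I_(ncosts I), nvar st 3 = j ->
        A 8%N (enum_rank s) = resid j (dev d) s].
have [||||||st' ex Ist'] := @exec_for_ground Inv dev_body st => //.
  move=> s st1 st1i st14 st13 st1a A t.
  have st1d : arr st1 10 0 = d by rewrite st1a.
  have [st10 _ _] := st1i.
  rewrite /dev_body /= (beval_capped st1i st14) st1d.
  rewrite ltnS leq_eqVlt => /orP[/eqP/val_inj/enum_rank_inj->|ts].
    rewrite /dev /rate; case: ifP => cs /=; rewrite st14 eqxx.
      rewrite (reval_sgn st1i st14) (reval_cap st1i st14).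
      split=> // j jE; rewrite st13 jE st10 (cost_cell _ st1i).
      by rewrite /resid /dev cs.
    rewrite (reval_sgn st1i st14) (reval_ratio st1i st14) st1d.
    rewrite (weight_cell _ st1i) div1r.
    split=> // j jE; rewrite st13 jE st10 (cost_cell _ st1i).
    by rewrite /resid /dev cs.
  have [A7 A13 A8] := A t ts.
  by case: ifP => _ /=; rewrite st14 (ltn_eqF ts).
by exists st' => // s; apply: Ist' (ltn_ord _).
Qed.

Lemma exec_measure st (F : {set ground I}) (x rt : ground I -> R) : holds_input st ->
    (forall s, arr st 9 (enum_rank s) = (s \in F)%:R) ->
    (forall s, arr st 8 (enum_rank s) = x s) ->
    (forall s, arr st 13 (enum_rank s) = rt s) ->
  exists2 st', exec O measure_answer st 0 st' &
    arr st' 11 0 = excess x F /\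
    arr st' 12 0 = \sum_s incid_diff F s ^+ 2 * rt s.
Proof.
move=> sti st9 st8 st13.
pose st1 := run (Seq (set_scalar 11 (num 0)) (set_scalar 12 (num 0))) st.
have ex1 : exec O (Seq (set_scalar 11 (num 0)) (set_scalar 12 (num 0))) st 0 st1.
  exact: exec_run.
have st1i : holds_input st1 by apply: holds_input_frame sti ex1 _ _ _.
pose Inv i (A : nat -> nat -> R) :=
  A 11%N 0%N = \sum_(s | (enum_rank s < i)%N) incid_diff F s * x s /\
  A 12%N 0%N = \sum_(s | (enum_rank s < i)%N) incid_diff F s ^+ 2 * rt s.
have sumS i (f : ground I -> R) s : enum_rank s = i :> nat ->
    \sum_(t | (enum_rank t < i.+1)%N) f t =
    \sum_(t | (enum_rank t < i)%N) f t + f s.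
  move=> si; rewrite (bigD1 s) /= ?si // addrC; congr (_ + _).
  apply: eq_bigl => t; rewrite ltnS [RHS]ltn_neqAle andbC -si.
  by rewrite (inj_eq val_inj) (inj_eq enum_rank_inj).
have [||||||st' ex [I1 I2]] := @exec_for_ground Inv sums_body st1 => //.
- by split; rewrite big_pred0_eq.
- move=> s st2 st2i st24 _ st2a [A11 A12].
  have st2E a : a \in [:: 8; 9; 13] -> arr st2 a = arr st a.
    by rewrite !inE => /or3P[] /eqP->; rewrite st2a.
  split; rewrite (sumS _ _ s) //= st24 (Fstar_cell _ st2i) (st2E 9 isT) ?st9.
    by rewrite A11 (st2E 8 isT) ?st8.
  by rewrite A12 (st2E 13 isT) ?st13 expr2.
exists st'; last first.
  rewrite I1 I2; split; apply: eq_bigl => s; exact: ltn_ord.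
rewrite -[0%N]/(0 + (0 + 0))%N.
by apply: ExecSeq; last apply: ExecSeq ex; exact: ExecAssignR.
Qed.
End Cells.

(** * Correctness and oracle complexity *)

Section Newton.
Variables (R : realType) (I : input R) (FF : {set {set ground I}}).
Variable O : (ground I -> R) -> {set ground I}.
Hypotheses (Iwf : wf_input I) (FstarFF : Fstar I \in FF) (OFF : is_oracle FF O).
Implicit Types (st : state R) (F : {set ground I}) (j : 'I_(ncosts I)).

#[local] Notation radius st := (arr st 10 0).
#[local] Notation exc j d F := (excess (resid j (dev d)) F).

Lemma exec_newton_step st j : holds_input I st -> nvar st 3 = j ->
  exists F st', [/\ F \in FF,
    forall F', F' \in FF -> exc j (radius st) F' <= exc j (radius st) F,
    exec O newton_step st 1 st'
    & if 0 < exc j (radius st) F then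
        if 0 < slope (radius st) F then
          [/\ nvar st' 2 = nvar st 2, nvar st' 3 = j
            & radius st' = radius st + exc j (radius st) F / slope (radius st) F]
        else nvar st' 2 = 0%N /\ nvar st' 3 = ncosts I
      else [/\ nvar st' 2 = nvar st 2, nvar st' 3 = j.+1
             & radius st' = radius st]].
Proof.
move=> sti st3; set d := radius st.
have [st1 ex1 st1P] := exec_dev O sti.
have st1i := holds_input_frame sti ex1 isT isT isT.
pose F := O (read_vec st1 8).
have x1 : read_vec st1 8 =1 resid j (dev d).
  by move=> s; have [_ _] := st1P s; apply.
have [FFF Fmax] := OFF (read_vec st1 8); rewrite -/F in FFF Fmax.
pose st2 := set_arr st1 9 (set_cells R F).
have ex2 : exec O (Query 8 9) st1 1 st2 by exact: ExecQuery.
have st2i := holds_input_frame st1i ex2 isT isT isT.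
have [||| st3' ex3 [f3 g3]] :=
  @exec_measure _ _ O st2 F (resid j (dev d)) (rate d) st2i.
- by move=> s; rewrite /= /set_cells vec_cellsE.
- by move=> s; rewrite -x1.
- by move=> s; have [_] := st1P s.
have st3i := holds_input_frame st2i ex3 isT isT isT.
have v3 x : x \notin [:: 4; 4]%N -> nvar st3' x = nvar st x.
  move=> x4; rewrite (exec_nvar_frame ex3 x4) /=.
  exact: exec_nvar_frame ex1 x4.
have d3 : radius st3' = d.
  by rewrite (exec_arr_frame ex3) //= (exec_arr_frame ex1).
have ex4 := exec_run O st3' (isT : straightline newton_update).
exists F, (run newton_update st3'); split=> //.
- move=> F' F'FF; rewrite -!(eq_excess _ x1) !excessE lerD2l lerN2.
  exact: Fmax.
- by apply: ExecSeq ex1 _; apply: ExecSeq ex2 _; apply: ExecSeq ex3 ex4.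
rewrite /= f3 g3 -/(slope d F).
case: (0 < exc j d F) => /=; last by rewrite !v3 // st3 addn1 d3.
case: (0 < slope d F) => /=; last by case: st3i => _ -> _.
by rewrite !v3 // d3.
Qed.

(** The loop invariant as long as infeasibility has not been detected. *)
Definition searching st : Prop :=
  [/\ nvar st 2 = 1%N, radius_ok I (radius st),
      forall p, feasible FF p -> radius st <= winfty_norm p
    & forall j F, (j < nvar st 3)%N -> F \in FF -> exc j (radius st) F <= 0].

(** The bound [a] on the slopes of the members of positive excess drops with
    every Newton step, so the current cost function takes at most [a.+1]
    queries; each later one starts with the bound [W] and takes at most [W.+1].
    The induction is on this bound [M] on the number of remaining queries. *)
Lemma exec_newton_loop (W : nat) : weightV_norm I = W%:R ->
  forall M st a, holds_input I st -> searching st ->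
    (forall j F, nvar st 3 = j -> F \in FF -> 0 < exc j (radius st) F ->
       slope (radius st) F <= a%:R) ->
    (beval st newton_guard ->
       (a.+1 + (ncosts I - (nvar st 3).+1) * W.+1 <= M)%N) ->
  exists q st', [/\ exec O (While newton_guard newton_step) st q st',
    (q <= M)%N, holds_input I st'
    & nvar st' 2 = 0%N /\ (forall p, ~ feasible FF p) \/
      searching st' /\ ~~ beval st' newton_guard].
Proof.
move=> WE; elim=> [|M IH] st a sti sts slope_a;
  (case guard : (beval st newton_guard); last first => [_|/(_ isT)]);
  try by exists 0%N, st; split=> //; [apply: ExecWhileF; rewrite guard
    |right; rewrite guard].
  by rewrite addSn.
rewrite addSn ltnS => aM.
have jk : (nvar st 3 < ncosts I)%N.
  by case: sti guard => _ <- _ /andP[].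
have [F [st' [FFF Fmax ex]]] :=
  @exec_newton_step st (Ordinal jk) sti erefl.
have sti' := holds_input_frame sti ex isT isT isT.
set j := Ordinal jk in Fmax *; set d := radius st in Fmax *.
have [st2 dok dmin dP] := sts.
have continue a' : searching st' ->
    (forall j F, nvar st' 3 = j -> F \in FF -> 0 < exc j (radius st') F ->
       slope (radius st') F <= a'%:R) ->
    (beval st' newton_guard ->
       (a'.+1 + (ncosts I - (nvar st' 3).+1) * W.+1 <= M)%N) ->
    exists q st', [/\ exec O (While newton_guard newton_step) st q st',
      (q <= M.+1)%N, holds_input I st'
      & nvar st' 2 = 0%N /\ (forall p, ~ feasible FF p) \/
        searching st' /\ ~~ beval st' newton_guard].
  move=> s' sl' b'; have [q [st'' [ex' qM i'' post]]] := IH st' a' sti' s' sl' b'.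
  by exists (1 + q)%N, st''; split=> //; apply: ExecWhileT ex ex'.
case: ifPn => [f0|]; last first.
  rewrite -leNgt => f0 [e2 e3 e10]; apply: (continue W).
  - rewrite /searching e2 e3 e10; split=> // i G.
    rewrite ltnS leq_eqVlt => /orP[/eqP ij GFF|]; last exact: dP.
    have -> : i = j by apply: val_inj.
    exact: le_trans (Fmax G GFF) f0.
  - by move=> i G _ _ _; rewrite -WE; apply: slope_le.
  - rewrite /= e3; case: sti' => -> -> _ /andP[jk' _].
    by apply: leq_trans aM; rewrite -mulSn subnSK ?leq_addl.
case: ifPn => [g0 [e2 e3 e10]|].
  (* A positive slope [m.+1] leaves the bound [m] for the next step. *)
  have [m gE] := slope_nat Iwf d F.
  have dd' : d <= radius st' by rewrite e10 lerDl divr_ge0 // ltW.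
  case: m gE => [|m] gE; first by rewrite gE ltxx in g0.
  apply: (continue m).
  - rewrite /searching e2 e3; split=> //; first exact: radius_ok_le dok dd'.
      move=> p pf; have := feasible_tangent Iwf FstarFF j d FFF pf.
      by rewrite e10 -ler_pdivrMr // -lerBrDl.
    move=> i G ij GFF; apply: le_trans (dP i G ij GFF).
    exact: excess_dev_le.
  - move=> i G; rewrite e3 => /val_inj <- GFF; rewrite e10 => G0.
    have := newton_slope_lt Iwf f0 g0 (Fmax G GFF) G0.
    have [m' ->] := slope_nat Iwf (d + exc j d F / slope d F) G.
    by rewrite gE ltr_nat ltnS ler_nat.
  - rewrite e3 => _; apply: leq_trans aM; rewrite leq_add2r.
    have := slope_a j F erefl FFF f0.
    by rewrite gE ler_nat.
(* The excess of [F] is positive and constant from [d] on: infeasible. *)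
rewrite -leNgt => g0 [e2 e3].
exists 1%N, st'; split=> //.
  rewrite -[1%N]addn0; apply: ExecWhileT ex _ => //; apply: ExecWhileF.
  by rewrite /= e3; case: sti' => _ -> _; rewrite ltnn.
left; split=> // p pf; have := feasible_tangent Iwf FstarFF j d FFF pf.
have -> : slope d F = 0 by apply/eqP; rewrite eq_le g0 slope_ge0.
by rewrite mulr0 leNgt f0.
Qed.

(** The vector read from the store agrees with [dev d] only pointwise. *)
Lemma optimal_dev d : radius_ok I d ->
    (forall p, feasible FF p -> d <= winfty_norm p) ->
    (forall j F, F \in FF -> exc j d F <= 0) ->
  forall p, p =1 dev d -> optimal FF p.
Proof.
move=> dok dmin dP p pE.
have np : winfty_norm p <= d.
  apply: le_trans (norm_dev Iwf dok).
  by rewrite /winfty_norm; under eq_bigr do rewrite pE.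
split=> [|p' pf']; last exact: le_trans np (dmin p' pf').
apply/(feasibleE FstarFF); split=> [s|j F FFF].
  by rewrite pE; apply: dev_within_bounds.
rewrite (@eq_excess _ _ _ (resid j (dev d))) ?dP // => s.
by rewrite /resid pE.
Qed.

Lemma exec_newton (W : nat) : weightV_norm I = W%:R ->
  exists q st, [/\ exec O newton (init_state I) q st,
    (q <= (0 < #|ground I|) * (ncosts I * W.+1))%N
    & correct_output FF (output I st)].
Proof.
move=> WE; pose st0 := set_nvar (init_state I) 2 1.
have ex0 : exec O (AssignN 2 (NConst 1)) (init_state I) 0 st0.
  exact: ExecAssignN.
have st0i : holds_input I st0 by split.
have [//|st1 ex1 [ok1 min1]] := exec_radius O Iwf st0i.
have st1i := holds_input_frame st0i ex1 isT isT isT.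
have st13 : nvar st1 3 = 0%N by rewrite (exec_nvar_frame ex1).
have [|||q [st2 [ex2 qM st2i post]]] :=
  exec_newton_loop WE (M := (0 < #|ground I|) * (ncosts I * W.+1)) (a := W) st1i.
- split=> //; first by rewrite (exec_nvar_frame ex1).
    by move=> p /(feasibleE FstarFF)[/min1].
  by move=> j F; rewrite st13.
- by move=> j F _ _ _; rewrite -WE; apply: slope_le.
- rewrite /= st13; case: st1i => -> -> _ /andP[k0 ->].
  by rewrite mul1n -mulSn subnSK // subn0.
have [st3 ex3 st3P] := exec_dev O st2i.
exists (0 + (0 + (q + 0)))%N, st3; split; last 2 first.
- by rewrite !add0n addn0.
- have st32 : nvar st3 2 = nvar st2 2 by rewrite (exec_nvar_frame ex3).
  rewrite /output st32; case: post => [[-> nof]|].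
    by case=> p; apply: nof.
  move=> [[-> ok2 min2 P2] guard] /=; apply: optimal_dev ok2 min2 _ _ _ => //.
    move=> j F FFF; move: guard => /=; case: (st2i) => -> -> _.
    rewrite negb_and -!leqNgt => /orP[kj|].
      by apply: P2 => //; apply: leq_trans kj.
    rewrite leqn0 => /eqP/card0_eq n0.
    by rewrite /excess big1 // => s; have := n0 s.
  by move=> s; have [] := st3P s.
- by apply: ExecSeq ex0 _; apply: ExecSeq ex1 _; apply: ExecSeq ex2 ex3.
Qed.

End Newton.

Theorem corollary13 (R : realType) :
  exists (P : cmd) (C : nat),
    forall (I : input R) (FF : {set {set ground I}})
           (O : (ground I -> R) -> {set ground I}),
      wf_input I -> Fstar I \in FF -> is_oracle FF O ->
      exists (q : nat) (st : state R),
        [/\ exec O P (init_state I) q st,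
            q%:R <= C%:R * (ncosts I)%:R * #|ground I|%:R * weightV_norm I
          & correct_output FF (output I st)].
Proof.
exists newton, 2%N => I FF O Iwf FstarFF OFF.
have [W WE W0] := weightV_normP Iwf.
have [q [st [ex qb ok]]] := exec_newton Iwf FstarFF OFF WE.
exists q, st; split=> //; rewrite WE -!natrM ler_nat.
by apply: leq_trans qb _; move: W0; case: #|ground I| => [|n] /=; nia.
Qed.
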